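(* There exist finitely generated groups with property $\mathrm{FG}$ but not property $\mathrm{FM}$.
   Context: For functions $f,g\colon\mathbb{N}\to\mathbb{N}$, $f\preceq g$ means that there is $C>0$ with $f(n)\le Cg(Cn)$ for all $n$. For a discrete metric space $\Gamma$, $\overline{b}_\Gamma(n)=\sup_{v\in\Gamma}|B_\Gamma(v,n)|$, where $B_\Gamma(v,n)$ is the ball of radius $n$ around $v$; $\Gamma$ has bounded geometry if $\overline{b}_\Gamma(n)<\infty$ for all $n$. The wobbling group $W(\Gamma)$ is the group of permutations $\sigma$ of $\Gamma$ with $\sup_{v}d_\Gamma(v,\sigma(v))<\infty$. A group $G$ has property $\mathrm{FG}$ if for every discrete metric space $\Gamma$ of bounded geometry such that $\exp(n)\not\preceq\overline{b}_\Gamma(n)$, every homomorphism $G\to W(\Gamma)$ has finite image. A group $G$ has property $\mathrm{FM}$ if every $G$-action on a set which preserves an invariant mean (a finitely additive probability measure defined on all subsets) has a finite orbit. *)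

(* Defs.v *)
From HB Require Import structures.
From mathcomp Require Import all_boot all_order all_algebra.
From mathcomp Require Import all_classical all_reals all_analysis.

Set Implicit Arguments.
Unset Strict Implicit.
Unset Printing Implicit Defensive.

Import Order.TTheory GRing.Theory Num.Theory.
Import Algebra.

Local Open Scope classical_set_scope.
Local Open Scope ring_scope.

(* Permutations of an arbitrary, possibly infinite, type; the group law is
   (s * t)(x) = s (t x). *)
Record sym (T : Type) := Sym {
  sym_fun :> T -> T;
  sym_bij : `[< bijective sym_fun >]
}.

HB.instance Definition _ (T : Type) := [isSub for @sym_fun T].
HB.instance Definition _ (T : Type) := gen_eqMixin (sym T).
HB.instance Definition _ (T : Type) := gen_choiceMixin (sym T).

Section SymGroup.
Variable T : Type.
Implicit Types s t u : sym T.

Lemma symP s : bijective s. Proof. exact/asboolP/sym_bij. Qed.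

Lemma sym_ext s t : s =1 t -> s = t.
Proof. by move=> st; apply: val_inj; exact: funext. Qed.

Lemma sym_inv_ex s : exists g : T -> T, cancel s g /\ cancel g s.
Proof. by case: (symP s) => g sK gK; exists g. Qed.

Definition sym_inv_fun s : T -> T := projT1 (cid (sym_inv_ex s)).

Lemma sym_inv_funK s : cancel s (sym_inv_fun s).
Proof. by rewrite /sym_inv_fun; case: cid => g [] /=. Qed.

Lemma sym_funK s : cancel (sym_inv_fun s) s.
Proof. by rewrite /sym_inv_fun; case: cid => g [] /=. Qed.

Definition sym_one : sym T :=
  @Sym T id (asboolT (inv_bij (fun _ => erefl))).

Definition sym_mul s t : sym T :=
  @Sym T (s \o t) (asboolT (bij_comp (symP s) (symP t))).

Definition sym_inv s : sym T :=
  @Sym T (sym_inv_fun s) (asboolT (Bijective (sym_funK s) (sym_inv_funK s))).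

Lemma sym_mulA : associative sym_mul.
Proof. by move=> s t u; exact: sym_ext. Qed.

Lemma sym_1mul : left_id sym_one sym_mul.
Proof. by move=> s; exact: sym_ext. Qed.

Lemma sym_mul1 : right_id sym_one sym_mul.
Proof. by move=> s; exact: sym_ext. Qed.

Lemma sym_Vmul : left_inverse sym_one sym_inv sym_mul.
Proof. by move=> s; apply: sym_ext => x; exact: sym_inv_funK. Qed.

Lemma sym_mulV : right_inverse sym_one sym_inv sym_mul.
Proof. by move=> s; apply: sym_ext => x; exact: sym_funK. Qed.

HB.instance Definition _ := isGroup.Build (sym T)
  sym_mulA sym_1mul sym_mul1 sym_Vmul sym_mulV.

End SymGroup.

Definition is_wobbling (R : realType) (X : metricType R) : {pred sym X} :=
  fun s => `[< has_ubound (range (fun v : X => mdist v (s v))) >].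

Lemma is_wobbling_closed (R : realType) (X : metricType R) :
  group_closed (@is_wobbling R X).
Proof.
split; first by apply/asboolP; exists 0 => _ [v _ <-]; rewrite mdistxx.
move=> s t /asboolP[a sa] /asboolP[b tb].
apply/asboolP; exists (b + a) => _ [v _ <-].
change (mdist v (s (sym_inv_fun t v)) <= b + a).
apply: (le_trans (metric_triangle _ (sym_inv_fun t v) _)).
apply: lerD; last by apply: sa; exists (sym_inv_fun t v).
by apply: tb; exists (sym_inv_fun t v) => //; rewrite sym_funK metric_sym.
Qed.

(* The wobbling group, as a subgroup of the group of permutations. *)
Record wobbling (R : realType) (X : metricType R) := Wobbling {
  wobbling_sym :> sym X;
  wobbling_symP : wobbling_sym \in @is_wobbling R X
}.

HB.instance Definition _ (R : realType) (X : metricType R) :=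
  [isSub for @wobbling_sym R X].
HB.instance Definition _ (R : realType) (X : metricType R) :=
  [Choice of wobbling X by <:].
HB.instance Definition _ (R : realType) (X : metricType R) :=
  SubChoice_isSubGroup.Build (sym X) (@is_wobbling R X) (wobbling X)
    (@is_wobbling_closed R X).

(* Balls are closed: with open balls the ball of radius 0 would be empty, and
   [growth_le] below compares values at [n = 0] as well. *)
Definition max_growth (R : realType) (X : metricType R) (n : nat) : \bar R :=
  ereal_sup (range (fun v : X => counting [set w : X | mdist v w <= n%:R])).

Definition bounded_geometry (R : realType) (X : metricType R) : Prop :=
  forall n, (max_growth X n < +oo)%E.

(* Extended-real values accommodate both suprema of cardinalities and the
   exponential. *)
Definition growth_le (R : realType) (f g : nat -> \bar R) : Prop :=
  exists2 C : nat, (0 < C)%N &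
    forall n, (f n <= C%:R%:E * g (C * n)%N)%E.

Definition exp_growth (R : realType) (n : nat) : \bar R := (expR n%:R)%:E.

Definition discrete_metric (R : realType) (X : metricType R) : Prop :=
  forall v : X, open [set v].

Definition property_FG (R : realType) (G : groupType) : Prop :=
  forall X : metricType R,
    discrete_metric X -> bounded_geometry X ->
    ~ growth_le (@exp_growth R) (max_growth X) ->
    forall phi : {multiplicative G -> wobbling X}, finite_set (range phi).

Definition is_action (G : groupType) (X : Type) (act : G -> X -> X) : Prop :=
  (forall x, act 1%g x = x) /\
  (forall g h x, act (g * h)%g x = act g (act h x)).

Definition is_mean (R : realType) (X : Type) (m : set X -> R) : Prop :=
  [/\ forall A, 0 <= m A,
      m setT = 1
    & forall A B, A `&` B = set0 -> m (A `|` B) = m A + m B].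

Definition invariant_mean (R : realType) (G : groupType) (X : Type)
    (act : G -> X -> X) (m : set X -> R) : Prop :=
  is_mean m /\ forall g A, m (act g @` A) = m A.

Definition property_FM (R : realType) (G : groupType) : Prop :=
  forall (X : Type) (act : G -> X -> X), is_action act ->
    (exists m : set X -> R, invariant_mean act m) ->
    exists x : X, finite_set (range (act^~ x)).

Definition finitely_generated (G : groupType) : Prop :=
  exists S : seq G, forall H : {pred G},
    group_closed H -> {subset S <= H} -> forall g, g \in H.

(* Main.v *)
Require Import Defs.
From HB Require Import structures.
From mathcomp Require Import all_boot all_order all_algebra.
From mathcomp Require Import all_classical all_reals all_analysis.
From mathcomp Require Import finmap zify ring lra.

Set Implicit Arguments.
Unset Strict Implicit.
Unset Printing Implicit Defensive.

Import Order.TTheory GRing.Theory Num.Theory.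
Import numFieldNormedType.Exports.

Local Open Scope classical_set_scope.
Local Open Scope ring_scope.

(** The group is a group of permutations of the set of triples (k, v, c), with
k an integer, v a natural number and c one of five copies.  It is generated by
- an element a, which maps (k, v, None) to (k + 1, v, None) and fixes the other
  copies;
- the four transpositions of the copy None with another copy;
- an involution g, which moves the last binary digit of v to the end of k:
  (k, v) with extra digit j becomes (2k + j, v / 2) with extra digit v mod 2.
  Digits are encoded by copies: those of the form Some (false, j) carry the
  digit j before the move, those of the form Some (true, i) the digit i after
  it.

Let w be a times the transposition of None and some other copy.  On these two
copies w is a square root of the map k |-> k + 1, so it is again an increment,
of the integer obtained by appending one more binary digit to k.  Up to
transpositions of the copies, g performs exactly this appending, so it conjugates
w to the increment of k on two copies, which is the square of w.  Hence w is
conjugate to its own square.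

Property FG.  If s conjugates w to its square, then w ^ N is a word of length
O(log N) in w and s.  In a wobbling group, the points w ^ N x with N < 2 ^ n
are therefore within distance O(n) of x.  When the growth of the space is not
exponential, they cannot all be distinct for every n, so the orbits of w have
bounded size and w has finite order ([distorted_finite_order]).  An element of
finite order conjugate to its square has odd order, and is thus a power of
its square; here this says that a transposition is, in the image, a product of
powers of two conjugates of a which it exchanges.  So the conjugates coincide,
all transpositions become the same power of a, and the image of the whole group
is a finite abelian group ([gluing_generated_finite]).

Property FM fails.  Let F be the set of triples with 2 ^ d <= v < 2 ^ (d + 1)
and 0 <= k < 2 ^ (D - d) for some d <= D.  It has D + 1 levels d of equal size;
g maps a level to an adjacent one, transpositions preserve levels, and a only
displaces end points of intervals.  So each generator moves a proportion
O(1 / D) of F, and a limit of the uniform measures along an ultrafilter is an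
invariant mean ([site_action_mean]).  All orbits are infinite because conjugates
of a translate k. *)

(** * Distorted elements of wobbling groups *)

Section Displacement.
Variables (R : realType) (X : metricType R).
Implicit Types (g h w s : wobbling X) (K L : nat).

Definition displaced_by g K := forall v : X, mdist v (g v) <= K%:R.

Lemma displaced_by_ex g : exists K, displaced_by g K.
Proof.
have /asboolP[K gK] := wobbling_symP g.
exists (Num.bound `|K|) => v.
apply: le_trans (ltW (le_lt_trans (ler_norm K) (archi_boundP (normr_ge0 K)))).
by apply: gK; exists v.
Qed.

Lemma displaced_by1 : displaced_by 1%g 0.
Proof. by move=> v; rewrite mdistxx. Qed.

Lemma displaced_byM g h K L :
  displaced_by g K -> displaced_by h L -> displaced_by (g * h)%g (L + K).
Proof.
move=> gK hL v; rewrite natrD.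
exact: le_trans (metric_triangle _ (h v) _) (lerD (hL v) (gK (h v))).
Qed.

Lemma displaced_byV g K : displaced_by g K -> displaced_by (g^-1)%g K.
Proof.
move=> gK v; rewrite metric_sym.
by rewrite -[X in mdist _ X](sym_funK (g : sym X) v); apply: gK.
Qed.

(** Horner's rule on the binary digits of the exponent: passing from [w ^+ q] to
[w ^+ (2 * q)] costs only one conjugation by [s]. *)
Lemma displaced_by_expg w s K L n N :
    (w ^ s = w * w)%g -> displaced_by w K -> displaced_by s L -> (N < 2 ^ n)%N ->
  displaced_by (w ^+ N)%g (n * (K + L + L)).
Proof.
move=> ws wK sL; elim: n N => [|n IHn] N.
  by rewrite expn0 ltnS leqn0 => /eqP->; exact: displaced_by1.
move=> N2; have N2n : (N./2 < 2 ^ n)%N by move: N2; rewrite expnS; lia.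
have -> : (w ^+ N = w ^+ odd N * (s^-1 * (w ^+ N./2 * s)))%g.
  rewrite -conjgE conjXg ws -expg2 -expgnA -expgnDr.
  by rewrite -[in LHS](odd_double_half N) mul2n.
have -> : (n.+1 * (K + L + L) = (L + n * (K + L + L) + L) + K)%N by lia.
apply: displaced_byM; first by case: odd => v; [exact: wK|rewrite mdistxx].
by apply: displaced_byM (displaced_byV sL) _; apply: displaced_byM (IHn _ _) _.
Qed.

Lemma counting_ge (N : nat) (f : nat -> X) (A : set X) :
    (forall i, (i < N)%N -> A (f i)) ->
    (forall i j, (i < j < N)%N -> f i <> f j) ->
  (N%:R%:E <= counting A :> \bar R)%E.
Proof.
move=> fA f_inj; rewrite /counting; case: asboolP => [finA|_]; last exact: leey.
rewrite lee_fin ler_nat -(size_iota 0 N) -(size_map f); apply: uniq_leq_size.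
  rewrite map_inj_in_uniq ?iota_uniq// => i j; rewrite !mem_iota /= => iN jN fij.
  case: (ltngtP i j) => // ij; first by case: (f_inj i j); rewrite ?ij.
  by case: (f_inj j i); rewrite ?ij.
move=> x /mapP[i]; rewrite mem_iota => iN ->.
by change (f i \in fset_set A); rewrite in_fset_set//; exact/mem_set/fA.
Qed.

(** An orbit with [2 ^ n] distinct points [w ^+ i v] fits in a ball of radius
linear in [n]. *)
Lemma growth_of_long_orbits w s :
    (w ^ s = w * w)%g ->
    (forall n, exists v : X,
      forall i j, (i < j < 2 ^ n)%N -> (w ^+ i)%g v <> (w ^+ j)%g v) ->
  growth_le (@exp_growth R) (max_growth X).
Proof.
move=> ws long; have [K wK] := displaced_by_ex w; have [L sL] := displaced_by_ex s.
(* The hypothesis is applied at n * k, where 2 ^ k exceeds the base e of the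
   exponential. *)
set M := (K + L + L)%N; set e := expR (1 : R); set k := Num.bound e.
have e2k : e <= (2 ^ k)%:R.
  apply: le_trans (ltW (archi_boundP (expR_ge0 1))) _.
  by rewrite ler_nat ltnW// ltn_expl.
exists (k * M).+1 => // n.
have [v vlong] := long (n * k)%N.
apply: (@le_trans _ _ (2 ^ (n * k))%:R%:E).
  rewrite lee_fin -[n%:R]mul1r expRM_natr mulnC expnM natrX.
  by apply: lerXn2r; rewrite ?nnegrE ?expR_ge0 ?ler0n.
have ball2 : ((2 ^ (n * k))%:R%:E <= max_growth X ((k * M).+1 * n))%E.
  apply: le_trans (ereal_sup_ubound _); last by exists v.
  apply: counting_ge vlong => i i2 /=.
  apply: le_trans (displaced_by_expg ws wK sL i2 v) _.
  by rewrite ler_nat -/M; nia.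
apply: (le_trans ball2); apply: lee_pemull; last by rewrite lee_fin ler1n.
by apply: le_trans ball2; rewrite lee_fin ler0n.
Qed.

(** When the growth is not exponential, some [2 ^ n] bounds the size of all orbits
of [w], and then the factorial of [2 ^ n] is an exponent of [w]. *)
Lemma distorted_finite_order w s :
    ~ growth_le (@exp_growth R) (max_growth X) -> (w ^ s = w * w)%g ->
  exists2 m, (0 < m)%N & (w ^+ m = 1)%g.
Proof.
move=> slow ws.
have [n nP] : exists n, forall v : X,
    exists i j, (i < j < 2 ^ n)%N /\ (w ^+ i)%g v = (w ^+ j)%g v.
  apply: contrapT => /forallNP short; apply/slow/(growth_of_long_orbits ws) => n.
  have /existsNP[v vP] := short n; exists v => i j ij wij.
  by apply: vP; exists i, j.
exists (2 ^ n)`!; first exact: fact_gt0.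
apply: val_inj; apply: sym_ext => v /=.
have [i [j [/andP[ij j2] wij]]] := nP v.
have wfix : (w ^+ (j - i))%g v = v.
  apply: (bij_inj (symP (w ^+ i)%g)); rewrite wij.
  by rewrite -[in RHS](subnKC (ltnW ij)) expgnDr.
have /dvdnP[q ->] : (j - i %| (2 ^ n)`!)%N by apply: dvdn_fact; lia.
rewrite mulnC expgnA; elim: q => [|q IHq]; first by rewrite expg0.
rewrite expgSr; change (((w ^+ (j - i)) ^+ q)%g ((w ^+ (j - i))%g v) = v).
by rewrite wfix.
Qed.

End Displacement.

(** * Groups with the gluing relations *)

Section Gluing.
Local Open Scope group_scope.

(** Being conjugate to its square, [w] has the same order as its square; this
order, if finite, is odd. *)
Lemma self_square_root (H : groupType) (w s : H) m :
  w ^ s = w * w -> (0 < m)%N -> w ^+ m = 1 -> exists k, w = (w * w) ^+ k.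
Proof.
move=> ws; elim/ltn_ind: m => m IHm m_gt0 wm.
have mE := odd_double_half m; case: (boolP (odd m)) => m_odd.
  exists (m./2).+1; rewrite -expg2 -expgnA.
  have -> : (2 * (m./2).+1 = m + 1)%N by lia.
  by rewrite expgnDr wm mul1g expg1.
apply: (IHm m./2); [lia..|].
apply: (@conjg_inj _ s); rewrite conj1g conjXg ws -expg2 -expgnA -wm.
by congr (_ ^+ _); lia.
Qed.

(** The relations between the generators that the argument uses.  Here [t c] is
meant to be the transposition of a base copy with the copy [c], and [a] lives on
the base copy, so that [t c * a * t c] is its conjugate living on copy [c].  The
elements [t c] and [g] are involutions, so all conjugations can be written
without inverses; the relations then can be checked on permutations by
evaluation. *)
Record gluing_relations (H : groupType) (a g : H) (t : bool * bool -> H) : Prop :=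
  GluingRelations {
  glue_tt : forall c, t c * t c = 1;
  glue_gg : g * g = 1;
  glue_ttt : forall c d, t c * t d * t c = t d * t c * t d;
  glue_tat : forall c d, c != d -> t d * (t c * a * t c) * t d = t c * a * t c;
  glue_aa : forall c, a * (t c * a * t c) = t c * a * t c * a;
  glue_ga : a * g = g * a;
  glue_split :
    g * (t (false, false) * (a * t (false, true)) * t (false, false)) * g =
    t (true, false) * a * t (true, false) * (t (true, true) * a * t (true, true))
}.

Lemma morph_mulg1 (G H : groupType) (f : G -> H) :
  {morph f : x y / x * y} -> f 1 = 1.
Proof. by move=> fM; apply: (@mulgI _ (f 1)); rewrite -fM !mulg1. Qed.

Lemma gluing_relations_morph (G H : groupType) (f : G -> H) a g t :
    {morph f : x y / x * y} ->
  gluing_relations a g t -> gluing_relations (f a) (f g) (f \o t).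
Proof.
move=> fM [tt gg ttt tat aa ga dbl].
split=> [c||c d|c d /tat eq_cd|c||]; rewrite /= -?fM.
- by rewrite tt morph_mulg1.
- by rewrite gg morph_mulg1.
- by rewrite ttt.
- by rewrite eq_cd.
- by rewrite aa.
- by rewrite ga.
- by rewrite dbl.
Qed.

Section Consequences.
Variables (H : groupType) (a g : H) (t : bool * bool -> H).
Hypothesis rel : gluing_relations a g t.

Let tV c : (t c)^-1 = t c. Proof. exact/mulg1_eq/(glue_tt rel). Qed.
Let gV : g^-1 = g. Proof. exact/mulg1_eq/(glue_gg rel). Qed.
Let tJ c x : t c * x * t c = x ^ t c. Proof. by rewrite conjgE tV mulgA. Qed.
Let gJ x : g * x * g = x ^ g. Proof. by rewrite conjgE gV mulgA. Qed.
Let tJK c x : (x ^ t c) ^ t c = x.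
Proof. by rewrite -conjgM (glue_tt rel) conjg1. Qed.
Let aJ c d : c != d -> (a ^ t c) ^ t d = a ^ t c.
Proof. by move=> cd; rewrite -!tJ; exact: glue_tat rel _ _ cd. Qed.

Notation w := (a * t (false, true)).

Lemma gluing_square : w * w = a * a ^ t (false, true).
Proof. by rewrite -tJ !mulgA. Qed.

(** The relation [glue_split] conjugates [w] to the product of [a] on the two
copies with first label true, and transpositions bring these two copies to the
two that support [w], where the product is the square of [w]. *)
Lemma gluing_distorted : exists s, w ^ s = w * w.
Proof.
exists (t (false, false) * g * t (true, false) *
  (t (false, true) * t (true, true) * t (false, true))).
have wg : (w ^ t (false, false)) ^ g = a ^ t (true, false) * a ^ t (true, true).
  by rewrite -[_ ^ g]gJ -[_ ^ t _]tJ (glue_split rel) !tJ.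
rewrite !conjgM wg gluing_square (conjMg (a ^ _) (a ^ _)) tJK (aJ (c := (true, true)))//.
rewrite (conjMg a (a ^ _)) (aJ (c := (true, true)))//.
by rewrite (conjMg (a ^ _) (a ^ _)) tJK aJ// (conjMg (a ^ _) a) tJK.
Qed.

(** The transposition [u] exchanging [a] and [a ^ u] is a word in these two
commuting elements, hence commutes with [a]; so [a] equals all its conjugates,
and then the braid relations identify all transpositions. *)
Lemma gluing_collapse m : (0 < m)%N -> w ^+ m = 1 ->
  a ^+ (2 * m) = 1 /\ exists n, forall c, t c = a ^+ n.
Proof.
move=> m_gt0 wm; have [s ws] := gluing_distorted.
have [k wk] := self_square_root ws m_gt0 wm.
set u := t (false, true).
have uE : u = a^-1 * (a * a ^ u) ^+ k by rewrite -gluing_square -wk mulKg.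
have aau : commute a (a ^ u) by rewrite -tJ; exact: glue_aa rel _.
have au : commute a u.
  rewrite uE; apply: commuteM; first exact/commuteV/commute_refl.
  by apply/commuteX/commuteM => //; exact: commute_refl.
have auE : a ^ u = a by apply/conjg_fixP/commgP.
have a2 : a ^+ 2 = w ^+ 2 by rewrite !expg2 gluing_square auE.
have a2m : a ^+ (2 * m) = 1.
  by rewrite expgnA a2 -expgnA mulnC expgnA wm expg1n.
have a2m1 : a^-1 = a ^+ (2 * m).-1.
  by apply: mulg1_eq; rewrite -expgS prednK ?muln_gt0.
split=> //; exists ((2 * m).-1 + 2 * k)%N.
have {}uE : u = a ^+ ((2 * m).-1 + 2 * k).
  by rewrite expgnDr -a2m1 expgnA expg2 {1}uE auE.
move=> c; case: (eqVneq (false, true) c) => [<- //|cE].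
have ac : a ^ t c = a by rewrite -[in LHS]auE -[RHS]auE; exact: aJ.
have uc : commute (t c) u.
  by rewrite uE; apply/commuteX/commute_sym/commgP/conjg_fixP.
(* As u commutes with t c, the braid relation u (t c) u = (t c) u (t c) becomes
   t c = u. *)
rewrite -uE -[RHS]mulg1 -(glue_tt rel c) mulgA -uc -(glue_ttt rel).
by rewrite -/u -uc -mulgA (glue_tt rel) mulg1.
Qed.

(** A finite subgroup containing the generators: the set of the products
[a ^+ i * g ^+ j]. *)
Lemma gluing_generated_finite m : (0 < m)%N -> w ^+ m = 1 ->
  exists P : {pred H}, [/\ group_closed P, finite_set [set` P],
    a \in P, g \in P & forall c, t c \in P].
Proof.
move=> m_gt0 /(gluing_collapse m_gt0)[]; set N := (2 * m)%N => aN [n tn].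
have N_gt0 : (0 < N)%N by rewrite muln_gt0.
have aX i : a ^+ i = a ^+ (i %% N).
  by rewrite {1}(divn_eq i N) expgnDr mulnC expgnA aN expg1n mul1g.
have gX i : g ^+ i = g ^+ odd i.
  rewrite -[in LHS](odd_double_half i) expgnDr -mul2n expgnA expg2 (glue_gg rel).
  by rewrite expg1n mulg1.
exists (fun x => `[< exists i j, x = a ^+ i * g ^+ j >]).
have mem i j : a ^+ i * g ^+ j \in
    (fun x : H => `[< exists i j, x = a ^+ i * g ^+ j >]).
  by apply/asboolP; exists i, j.
split.
- split; first by have := mem 0 0; rewrite mulg1.
  move=> x y /asboolP[i [j ->]] /asboolP[k [l ->]].
  have -> : a ^+ i * g ^+ j / (a ^+ k * g ^+ l) = a ^+ (i + N.-1 * k) * g ^+ (j + l).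
    have aV : a^-1 = a ^+ N.-1 by apply: mulg1_eq; rewrite -expgS prednK.
    rewrite invgM -!expVgn gV aV -expgnA (expgnDr a) -!mulgA; congr (_ * _).
    rewrite mulgA -expgnDr; apply: commute_sym.
    exact/commuteX2/(glue_ga rel).
  exact: mem.
- apply: (@sub_finite_set _ _
    ((fun ij : 'I_N * 'I_2 => a ^+ ij.1 * g ^+ ij.2) @` setT)); last exact: finite_image.
  move=> x /asboolP[i [j ->]].
  exists (Ordinal (ltn_pmod i N_gt0), inord (odd j)) => //=.
  by rewrite -aX inordK -?gX; case: (odd j).
- by have := mem 1%N 0%N; rewrite expg1 mulg1.
- by have := mem 0%N 1%N; rewrite expg1 mul1g.
- by move=> c; have := mem n 0%N; rewrite mulg1 tn.
Qed.

End Consequences.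
End Gluing.

(** * The subgroup generated by finitely many elements *)

Section Generated.
Local Open Scope group_scope.
Variables (H : groupType) (S : seq H).

Definition generated_pred : {pred H} := fun x =>
  `[< forall P : {pred H}, group_closed P -> {subset S <= P} -> x \in P >].

Lemma generated_closed : group_closed generated_pred.
Proof.
split; first by apply/asboolP => P [P1 _] _.
move=> x y /asboolP xP /asboolP yP; apply/asboolP => P clP SP.
by apply: clP.2; [exact: xP|exact: yP].
Qed.

Record generated := Generated {
  generated_val :> H;
  generated_valP : generated_val \in generated_pred
}.

HB.instance Definition _ := [isSub for @generated_val].
HB.instance Definition _ := [Choice of generated by <:].
HB.instance Definition _ :=
  SubChoice_isSubGroup.Build H generated_pred generated generated_closed.

Lemma mem_generated x : x \in S -> x \in generated_pred.
Proof. by move=> xS; apply/asboolP => P _; exact. Qed.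

(** The induction is on membership in the ambient group; [Q] transports a
predicate on the subgroup to the ambient group. *)
Lemma generated_ind (P : {pred generated}) : group_closed P ->
  (forall x : generated, val x \in S -> x \in P) -> forall x, x \in P.
Proof.
move=> clP SP x; have /asboolP xP := generated_valP x.
pose Q : {pred H} := fun y => `[< exists2 z : generated, z \in P & val z = y >].
have clQ : group_closed Q.
  split; first by apply/asboolP; exists 1; [exact: clP.1|].
  move=> _ _ /asboolP[y yP <-] /asboolP[z zP <-].
  by apply/asboolP; exists (y / z); [exact: clP.2|].
have SQ : {subset S <= Q}.
  by move=> y yS; apply/asboolP; exists (Generated (mem_generated yS)); [exact: SP|].
by have /asboolP[y yP /val_inj <-] := xP Q clQ SQ.
Qed.

Lemma generated_fg : finitely_generated generated.
Proof.
pose gens := pmap (insub : H -> option generated) S.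
exists gens => P clP SP; apply: generated_ind => // x xS; apply: SP.
by rewrite mem_pmap_sub.
Qed.

End Generated.

(** * Odometers and digit shifts *)

Section Sites.
Local Open Scope ring_scope.

(** The copy [None] is the base copy; it is fixed by the digit shift below. *)
Definition copy : finType := option (bool * bool).
Definition site : Type := (int * nat * copy)%type.

Definition advance_fun n (x : site) : site :=
  let: (k, v, c) := x in if c is None then (k + n, v, c) else x.

Lemma advance_funK n : cancel (advance_fun n) (advance_fun (- n)).
Proof. by case=> -[k v] [//|] /=; rewrite addrK. Qed.

Lemma advance_bij : bijective (advance_fun 1).
Proof.
exists (advance_fun (- 1)); first exact: advance_funK.
by move=> x; rewrite -{1}[1]opprK advance_funK.
Qed.

Definition transpose_copy (b : bool * bool) (c : copy) : copy :=
  if c is Some d then if d == b then None else c else Some b.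

Definition transpose_fun b (x : site) : site :=
  let: (k, v, c) := x in (k, v, transpose_copy b c).

Lemma transpose_funK b : involutive (transpose_fun b).
Proof.
case=> -[k v] [d|] /=; last by rewrite eqxx.
by case: (eqVneq d b) => [->|db] //=; rewrite (negPf db).
Qed.

(** The natural number [v] is a stack of binary digits: its last digit is popped
when [j] is pushed to the integer [k], and conversely.  The first label of the
copy tells which of the two moves is to be made, which makes the map an
involution. *)
Definition digit_shift_fun (x : site) : site :=
  let: (k, v, c) := x in
  match c with
  | Some (false, j) => (k * 2 + j%:Z, v./2, Some (true, odd v))
  | Some (true, i) => ((k %/ 2)%Z, (i + v.*2)%N, Some (false, (k %% 2)%Z == 1))
  | None => x
  end.

Lemma digit_shift_funK : involutive digit_shift_fun.
Proof.
case=> -[k v] [[[] j]|//] /=.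
  congr (_, _, _); last by congr (Some (_, _)); case: j => /=; lia.
    by case: eqP; lia.
  by case: j; lia.
congr (_, _, _); last by congr (Some (_, _)); case: j => /=; lia.
  by case: j => /=; lia.
lia.
Qed.

Definition advance : sym site := @Sym site _ (asboolT advance_bij).
Definition transpose b : sym site :=
  @Sym site _ (asboolT (inv_bij (transpose_funK b))).
Definition digit_shift : sym site := @Sym site _ (asboolT (inv_bij digit_shift_funK)).

Definition generators := advance :: digit_shift :: codom transpose.

Lemma sym_mulE (T : Type) (s t : sym T) x : (s * t)%g x = s (t x).
Proof. by []. Qed.

(** All relations but the last hold copy by copy.  In the last one, incrementing
[k] with one more binary digit is conjugated by the digit shift to [k + 1]. *)
Lemma site_relations : gluing_relations advance digit_shift transpose.
Proof.
split=> [c||c d|c d|c||]; try move=> cd; apply: sym_ext => -[[k v] e].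
- exact: transpose_funK.
- exact: digit_shift_funK.
- by rewrite !sym_mulE; move: c d e => [[] []] [[] []] [[[] []]|].
- by rewrite !sym_mulE; move: c d e cd => [[] []] [[] []] [[[] []]|].
- by rewrite !sym_mulE; move: c e => [[] []] [[[] []]|].
- by rewrite !sym_mulE; move: e => [[[] []]|].
- rewrite !sym_mulE; move: e => [[[] b]|] //; last first.
    by case: b; [exact: (digit_shift_funK (k, v, Some (false, true)))|
      exact: (digit_shift_funK (k, v, Some (false, false)))].
  (* The increment carries exactly when k is odd. *)
  case: b => /=; case kE: ((k %% 2)%Z == 1) => /=; congr (_, _, Some (_, _)); lia.
Qed.

End Sites.

(** * Means as limits along an ultrafilter *)

Section LimitMean.
Variable R : realType.

(** By compactness the filter has a cluster point in [[0, 1]], and an ultrafilter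
converges to its cluster points. *)
Lemma ultra_bounded_cvg (U : set_system nat) (u : nat -> R) : UltraFilter U ->
  (forall n, 0 <= u n <= 1) -> exists p : R, u @ U --> p.
Proof.
move=> ultraU u01.
have UF : ProperFilter (u @ U) by exact: fmap_proper_filter.
have UK : (u @ U) `[0, 1]%classic.
  by apply: nearW => n; rewrite /= in_itv /=; exact: u01.
have [p [_ clp]] := @segment_compact R 0 1 _ _ UK.
exists p => V pV; have [//|UnV] := in_ultra_setVsetC (u @^-1` V) ultraU.
by have [x []] := clp (~` V) V UnV pV.
Qed.

(** The limit is taken along one ultrafilter for all sets, so finite additivity
passes to it, and so does any invariance that holds asymptotically. *)
Lemma limit_mean (T : Type) (mu : nat -> set T -> R) :
    (forall n, is_mean (mu n)) ->
  exists2 m : set T -> R, is_mean m &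
    forall (g : T -> T) A, (fun n => mu n (g @^-1` A) - mu n A) @ \oo --> 0 ->
      m (g @^-1` A) = m A.
Proof.
move=> mu_mean.
have [U [ultraU ooU]] := ultraFilterLemma (eventually_filter : ProperFilter \oo).
have mu01 A n : 0 <= mu n A <= 1.
  have [mu0 mu1 muD] := mu_mean n; rewrite mu0 /= -mu1 -(setUv A) muD ?setICr//.
  by rewrite lerDl.
pose m A : R := projT1 (cid (ultra_bounded_cvg ultraU (mu01 A))).
have mP A : mu^~ A @ U --> m A by rewrite /m; case: cid.
have mE A l : mu^~ A @ U --> l -> m A = l.
  by move=> Al; apply: (cvg_unique _ (mP A) Al).
exists m; first split.
- move=> A; apply: (@closed_cvg _ _ U _ (mu^~ A) [set x | 0 <= x]) (mP A).
  + exact: closed_ge.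
  + by apply: nearW => n; have /andP[] := mu01 A n.
- apply: mE; under eq_fun do rewrite (let: And3 _ h _ := mu_mean _ in h).
  exact: cvg_cst.
- move=> A B AB; apply: mE.
  under eq_fun do rewrite (let: And3 _ _ h := mu_mean _ in h _ _ AB).
  exact: cvgD.
- move=> g A gA; apply: mE.
  have : (fun n => (mu n (g @^-1` A) - mu n A) + mu n A) @ U --> 0 + m A.
    by apply: cvgD => //; apply: cvg_trans gA => V /ooU.
  by rewrite add0r; under eq_fun do rewrite subrK.
Qed.

End LimitMean.

(** * Folner averages for the generators *)

Section FolnerAverages.
Variable R : realType.
Implicit Types (f : site -> R) (D d : nat).

(** Level [d] consists of [2 ^ d] intervals of length [2 ^ (D - d)]: halving [v]
halves the number of intervals and appending a digit to [k] doubles their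
length, so the digit shift maps levels onto levels exactly. *)
Definition level_sum D d f (c : copy) : R :=
  \sum_(u < 2 ^ d) \sum_(k < 2 ^ (D - d)) f (k%:Z, (2 ^ d + u)%N, c).

Definition folner_sum D f : R := \sum_(d < D.+1) \sum_(c : copy) level_sum D d f c.

Lemma sum_copy (F : copy -> R) :
  \sum_(c : copy) F c =
  F None + \sum_(j : bool) F (Some (false, j)) + \sum_(i : bool) F (Some (true, i)).
Proof.
rewrite (bigD1 None)//= -addrA; congr (_ + _).
rewrite (reindex_onto Some (fun c : copy => odflt (false, false) c))/=; last by case.
rewrite (eq_bigl xpredT); last by move=> b; rewrite eqxx.
rewrite (eq_bigr (fun p => F (Some (p.1, p.2)))); last by case.
rewrite -(pair_bigA _ (fun i j => F (Some (i, j))))/= !big_bool/=.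
by rewrite addrC.
Qed.

Lemma sum_parity n (h : nat -> R) :
  \sum_(i < 2 * n) h i = \sum_(i < n) \sum_(b : bool) h (b + i.*2)%N.
Proof.
elim: n => [|n IHn]; first by rewrite muln0 !big_ord0.
rewrite mulnS !big_ord_recr/= IHn big_bool/= mul2n -addrA; congr (_ + _).
by rewrite addrC.
Qed.

Lemma level_digit_shift D d f : (d < D)%N ->
  \sum_(j : bool) level_sum D d.+1 (f \o digit_shift) (Some (false, j)) =
  \sum_(i : bool) level_sum D d f (Some (true, i)).
Proof.
move=> dD; rewrite /level_sum.
rewrite exchange_big/= expnS.
rewrite (sum_parity _ (fun u => \sum_(j : bool) \sum_(k < 2 ^ (D - d.+1))
  f (digit_shift (k%:Z, (2 * 2 ^ d + u)%N, Some (false, j))))).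
rewrite [RHS]exchange_big/=; apply: eq_bigr => u _; apply: eq_bigr => i _.
have -> : (2 ^ (D - d) = 2 * 2 ^ (D - d.+1))%N by rewrite -expnS subnSK.
rewrite (sum_parity _ (fun k => f (k%:Z, (2 ^ d + u)%N, Some (true, i)))) exchange_big/=.
apply: eq_bigr => k _; apply: eq_bigr => j _; congr (f (_, _, Some (_, _))).
- by rewrite PoszD -muln2 PoszM addrC.
- by case: i; lia.
- by case: i; lia.
Qed.

Lemma level_sum1 D d c : (d <= D)%N -> level_sum D d (cst 1) c = 2 ^+ D.
Proof.
move=> dD; rewrite /level_sum /= !sumr_const !card_ord -mulrnA -expnD.
by rewrite subnK// natrX.
Qed.

Lemma level_bound D d f c : (forall x, 0 <= f x <= 1) -> (d <= D)%N ->
  0 <= level_sum D d f c <= 2 ^+ D.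
Proof.
move=> f01 dD; rewrite -(level_sum1 c dD); apply/andP; split.
  apply: sumr_ge0 => u _; apply: sumr_ge0 => k _.
  by have /andP[] := f01 (k%:Z, (2 ^ d + u)%N, c).
apply: ler_sum => u _; apply: ler_sum => k _.
by have /andP[] := f01 (k%:Z, (2 ^ d + u)%N, c).
Qed.

(** The digit shift exchanges the part of level [d + 1] in the copies
[Some (false, _)] with the part of level [d] in the copies [Some (true, _)]; only
the former copies on level [0] and the latter on level [D] have no counterpart. *)
Lemma folner_digit_shift D f : (forall x, 0 <= f x <= 1) ->
  `|folner_sum D (f \o digit_shift) - folner_sum D f| <= 4 * 2 ^+ D.
Proof.
move=> f01; have f01' x : 0 <= (f \o digit_shift) x <= 1 by exact: f01.
pose O d f := \sum_(j : bool) level_sum D d f (Some (false, j)).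
pose I d f := \sum_(i : bool) level_sum D d f (Some (true, i)).
have OI d : (d < D)%N -> O d.+1 (f \o digit_shift) = I d f by exact: level_digit_shift.
have IO d : (d < D)%N -> I d (f \o digit_shift) = O d.+1 f.
  have ff : (f \o digit_shift) \o digit_shift = f.
    by apply: funext => x; exact: (congr1 f (digit_shift_funK x)).
  by move=> dD; rewrite /I -level_digit_shift// ff.
have O01 d h : (forall x, 0 <= h x <= 1) -> (d <= D)%N -> 0 <= O d h <= 2 * 2 ^+ D.
  move=> h01 dD; rewrite /O big_bool/=.
  have := level_bound (Some (false, true)) h01 dD.
  have := level_bound (Some (false, false)) h01 dD; lra.
have I01 d h : (forall x, 0 <= h x <= 1) -> (d <= D)%N -> 0 <= I d h <= 2 * 2 ^+ D.
  move=> h01 dD; rewrite /I big_bool/=.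
  have := level_bound (Some (true, true)) h01 dD.
  have := level_bound (Some (true, false)) h01 dD; lra.
have sumE h : folner_sum D h = \sum_(d < D.+1) level_sum D d h None +
    (O 0%N h + \sum_(d < D) O d.+1 h) + (\sum_(d < D) I d h + I D h).
  have <- : \sum_(d < D.+1) I d h = \sum_(d < D) I d h + I D h.
    by rewrite big_ord_recr.
  have <- : \sum_(d < D.+1) O d h = O 0%N h + \sum_(d < D) O d.+1 h.
    by rewrite big_ord_recl.
  by rewrite -!big_split/=; apply: eq_bigr => d _; rewrite sum_copy.
have NE : \sum_(d < D.+1) level_sum D d (f \o digit_shift) None =
          \sum_(d < D.+1) level_sum D d f None by [].
have OIE : \sum_(d < D) O d.+1 (f \o digit_shift) = \sum_(d < D) I d f.
  by apply: eq_bigr => d _; exact: OI.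
have IOE : \sum_(d < D) I d (f \o digit_shift) = \sum_(d < D) O d.+1 f.
  by apply: eq_bigr => d _; exact: IO.
rewrite !sumE NE OIE IOE.
have := O01 0%N _ f01 (leq0n D); have := O01 0%N _ f01' (leq0n D).
have := I01 D _ f01 (leqnn D); have := I01 D _ f01' (leqnn D).
rewrite ler_norml; lra.
Qed.

(** On each interval the sum telescopes to a difference of two end values, and
there are fewer than [2 ^ D.+1] intervals. *)
Lemma folner_advance D f : (forall x, 0 <= f x <= 1) ->
  `|folner_sum D (f \o advance) - folner_sum D f| <= 4 * 2 ^+ D.
Proof.
move=> f01.
have -> : folner_sum D (f \o advance) - folner_sum D f =
    \sum_(d < D.+1) \sum_(u < 2 ^ d)
      (f ((2 ^ (D - d))%N%:Z, (2 ^ d + u)%N, None) - f (0%N%:Z, (2 ^ d + u)%N, None)).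
  rewrite -sumrB; apply: eq_bigr => d _.
  have SE p : level_sum D d (f \o advance) (Some p) = level_sum D d f (Some p) by [].
  transitivity (level_sum D d (f \o advance) None - level_sum D d f None).
    by rewrite !sum_copy !big_bool/= !SE; ring.
  rewrite -sumrB; apply: eq_bigr => u _; rewrite -sumrB.
  have := telescope_sumr (fun k => f (k%:Z, (2 ^ d + u)%N, None)) (leq0n (2 ^ (D - d))).
  rewrite big_mkord => <-; apply: eq_bigr => k _ /=.
  by rewrite -PoszD addn1.
apply: (@le_trans _ _ (\sum_(d < D.+1) 2 ^+ d)).
  apply: le_trans (ler_norm_sum _ _ _) _; apply: ler_sum => d _.
  apply: le_trans (ler_norm_sum _ _ _) _.
  have -> : 2 ^+ d = \sum_(u < 2 ^ d) 1 :> R by rewrite sumr_const card_ord natrX.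
  apply: ler_sum => u _; rewrite ler_norml.
  have := f01 ((2 ^ (D - d))%N%:Z, (2 ^ d + u)%N, None).
  have := f01 (0%N%:Z, (2 ^ d + u)%N, None).
  lra.
have := subrX1 (2 : R) D.+1; rewrite exprS.
have : 0 <= 2 ^+ D :> R by apply: exprn_ge0.
lra.
Qed.

Lemma folner_transpose D b f : folner_sum D (f \o transpose b) = folner_sum D f.
Proof.
apply: eq_bigr => d _; rewrite [RHS](reindex_inj (h := transpose_copy b))//.
apply: (@can_inj _ _ _ (transpose_copy b)) => c.
by have /(congr1 snd) := transpose_funK b (0, 0%N, c).
Qed.

Definition folner_mean D (A : set site) : R :=
  folner_sum D \1_A / (5 * D.+1%:R * 2 ^+ D).

Lemma indic01 (A : set site) x : 0 <= (\1_A x : R) <= 1.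
Proof. by rewrite indicE; case: (_ \in _) => /=; rewrite lexx ler01. Qed.

Lemma folner_mean_is_mean D : is_mean (folner_mean D).
Proof.
have pos : 0 < 5 * D.+1%:R * 2 ^+ D :> R.
  by rewrite !mulr_gt0 ?ltr0n// exprn_gt0.
have sum0 A : 0 <= folner_sum D \1_A.
  apply: sumr_ge0 => d _; apply: sumr_ge0 => c _.
  by have /andP[] := level_bound (D := D) c (@indic01 A) (ltn_ord d).
split=> [A||A B AB].
- by rewrite divr_ge0// ltW.
- rewrite /folner_mean; have -> : folner_sum D \1_setT = 5 * D.+1%:R * 2 ^+ D.
    rewrite /folner_sum (eq_bigr (fun=> 5 * 2 ^+ D)).
      by rewrite sumr_const card_ord -[LHS]mulr_natr; lra.
    move=> d _; rewrite (eq_bigr (fun=> 2 ^+ D)).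
      by rewrite sumr_const card_option card_prod card_bool -[LHS]mulr_natl.
    by move=> c _; rewrite indicT level_sum1 // -ltnS.
  by rewrite divff// gt_eqF.
- rewrite /folner_mean -mulrDl; congr (_ / _).
  rewrite -big_split; apply: eq_bigr => d _; rewrite -big_split; apply: eq_bigr => c _.
  rewrite -big_split; apply: eq_bigr => u _; rewrite -big_split; apply: eq_bigr => k _.
  have := in_set0 (k%:Z, (2 ^ d + u)%N, c); rewrite -AB in_setI /= !indicE in_setU.
  by do 2 case: (_ \in _); rewrite ?addr0 ?add0r.
Qed.

(** The bound [4 * 2 ^+ D] is to be compared with the total mass
[5 * D.+1 * 2 ^+ D]. *)
Lemma folner_mean_asymptotically_invariant (g : sym site) (A : set site) :
    (forall D f, (forall x, 0 <= f x <= 1) ->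
      `|folner_sum D (f \o g) - folner_sum D f| <= 4 * 2 ^+ D) ->
  (fun D => folner_mean D (g @^-1` A) - folner_mean D A) @ \oo --> (0 : R).
Proof.
move=> gP; apply: (@squeeze_cvgr _ _ _ _ (fun D => - harmonic D) (@harmonic R)).
- apply: nearW => D; rewrite -ler_norml /folner_mean -mulrBl normrM.
  rewrite (_ : \1_(g @^-1` A) = \1_A \o g); last first.
    by apply: funext => x; rewrite /= !indicE;
       congr (nat_of_bool _)%:R; apply/idP/idP; rewrite !inE.
  have D0 : 0 < D.+1%:R :> R by rewrite ltr0n.
  have p0 : 0 < 2 ^+ D :> R by rewrite exprn_gt0.
  rewrite [X in _ * X]ger0_norm ?invr_ge0 ?mulr_ge0 ?(ltW D0) ?(ltW p0)//.
  rewrite ler_pdivrMr ?mulr_gt0//.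
  apply: le_trans (gP D _ (@indic01 A)) _; rewrite /harmonic.
  have -> : D.+1%:R^-1 * (5 * D.+1%:R * 2 ^+ D) = 5 * 2 ^+ D :> R.
    by field; rewrite gt_eqF.
  by rewrite ler_pM2r// ler_nat.
- by rewrite -[X in _ --> X]oppr0; apply: cvgN; exact: cvg_harmonic.
- exact: cvg_harmonic.
Qed.

End FolnerAverages.

(** * The group and its two properties *)

Definition site_group : groupType := generated generators.

Lemma advanceP : advance \in generated_pred generators.
Proof. by apply: mem_generated; rewrite mem_head. Qed.

Lemma digit_shiftP : digit_shift \in generated_pred generators.
Proof. by apply: mem_generated; rewrite !inE eqxx orbT. Qed.

Lemma transposeP b : transpose b \in generated_pred generators.
Proof. by apply: mem_generated; rewrite !inE codom_f !orbT. Qed.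

Definition group_advance : site_group := Generated advanceP.
Definition group_digit_shift : site_group := Generated digit_shiftP.
Definition group_transpose b : site_group := Generated (transposeP b).

Lemma group_relations : gluing_relations group_advance group_digit_shift group_transpose.
Proof.
have [tt gg ttt tat aa ga dbl] := site_relations.
split=> [c||c d|c d cd|c||]; apply: val_inj.
- exact: tt.
- exact: gg.
- exact: ttt.
- exact: tat.
- exact: aa.
- exact: ga.
- exact: dbl.
Qed.

Lemma site_group_ind (P : {pred site_group}) : group_closed P ->
    group_advance \in P -> group_digit_shift \in P ->
    (forall b, group_transpose b \in P) ->
  forall x, x \in P.
Proof.
move=> clP aP dP tP; apply: generated_ind => // x.
rewrite inE => /orP[/eqP xa|].
  by rewrite (_ : x = group_advance)//; exact: val_inj.
rewrite inE => /orP[/eqP xd|/codomP[b xt]].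
  by rewrite (_ : x = group_digit_shift)//; exact: val_inj.
by rewrite (_ : x = group_transpose b)//; exact: val_inj.
Qed.

(** The relations pass to the image of the group in the wobbling group, where the
distorted element has finite order. *)
Lemma site_group_FG (R : realType) : property_FG R site_group.
Proof.
move=> X _ _ slow phi.
have phirel := gluing_relations_morph (f := phi) (@gmulfM _ _ phi) group_relations.
have [s ws] := gluing_distorted phirel.
have [m m_gt0 wm] := distorted_finite_order slow ws.
have [P [clP finP aP gP tP]] := gluing_generated_finite phirel m_gt0 wm.
apply: sub_finite_set finP => _ [x _ <-].
change (x \in [pred x | phi x \in P]).
apply: site_group_ind x => //.
split; first by rewrite inE morph_mulg1 ?clP.1//; exact: gmulfM.
move=> x y xP yP; rewrite inE.
have -> : (phi (x / y) = phi x / phi y)%g.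
  by apply: (@mulIg _ (phi y)); rewrite -gmulfM !mulgVK.
exact: clP.2.
Qed.

Section PropertyFM.
Variable R : realType.

Definition site_action (g : site_group) : site -> site := val g.

Lemma site_action_is_action : is_action site_action.
Proof. by []. Qed.

Lemma site_action_mean : exists m : set site -> R, invariant_mean site_action m.
Proof.
have [m m_mean m_inv] := limit_mean (@folner_mean_is_mean R).
exists m; split=> //.
pose P : {pred site_group} := fun g => `[< forall A, m (site_action g @` A) = m A >].
have asymP (g : site_group) :
    (forall D f, (forall x, 0 <= f x <= 1) ->
      `|folner_sum D (f \o val g) - folner_sum D f| <= 4 * 2 ^+ D :> R) -> g \in P.
  move=> gP; apply/asboolP => A.
  rewrite -(m_inv _ _ (folner_mean_asymptotically_invariant _ gP)).
  congr m; apply/seteqP; split=> [v [w Aw /(bij_inj (symP (val g))) <-]//|v Av].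
  by exists v.
suff PP g : g \in P by move=> g A; have /asboolP := PP g.
apply: site_group_ind => [||| b].
- split; first by apply/asboolP => A; rewrite image_id.
  move=> x y /asboolP xP /asboolP yP; apply/asboolP => A.
  have -> : site_action (x / y)%g @` A = site_action x @` (site_action (y^-1)%g @` A).
    by rewrite image_comp.
  rewrite xP -yP image_comp.
  rewrite (_ : site_action y \o site_action (y^-1)%g = id) ?image_id//.
  by apply: funext => v; exact: (sym_funK (val y)).
- by apply: asymP => D f; exact: folner_advance.
- by apply: asymP => D f; exact: folner_digit_shift.
- apply: asymP => D f _.
  by rewrite folner_transpose subrr normr0 mulr_ge0// exprn_ge0.
Qed.

(** On each copy, some conjugate of the advance translates [k] freely. *)
Lemma site_orbit_infinite x : infinite_set (range (site_action^~ x)).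
Proof.
case: x => -[k v] c.
have [h hE] : exists h : site_group, forall l, site_action h (l, v, c) = (l + 1, v, c).
  case: c => [b|]; last by exists group_advance.
  exists (group_transpose b * group_advance * group_transpose b)%g => l.
  by rewrite /site_action /= /transpose_fun /= eqxx.
have orbit n : (k + n%:Z, v, c) = site_action (h ^+ n)%g (k, v, c).
  elim: n => [|n IHn]; first by rewrite addr0.
  rewrite expgS -[RHS]/(site_action h (site_action (h ^+ n)%g (k, v, c))) -IHn hE.
  by rewrite -addrA -PoszD addn1.
move=> fin_orbit; apply: infinite_nat.
have := finite_preimage (f := fun n : nat => (k + n%:Z, v, c)) _ fin_orbit.
rewrite (_ : _ @^-1` _ = setT); last first.
  by apply/seteqP; split=> // n _; exists (h ^+ n)%g.
by apply=> i j _ _ [] /addrI [].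
Qed.

End PropertyFM.

Theorem corollary1p15 (R : realType) :
  exists G : groupType,
    [/\ finitely_generated G, property_FG R G & ~ property_FM R G].
Proof.
exists site_group; split.
- exact: generated_fg.
- exact: site_group_FG.
- move=> FM.
  have [x] := FM _ _ site_action_is_action (site_action_mean R).
  exact: site_orbit_infinite.
Qed.
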